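(* Let $n\ge 3$ and $p\in(0,1)$. (a) If $p=\alpha/(n-1)$ for an integer $\alpha\in\{1,\ldots,n-2\}$, then the Chebyshev bound is tight for $k=\alpha+1$ and for $k=n$, i.e. $\overline{P}(n,k,p)=CH(n,k,p)$ for these values of $k$. (b) If $p\le 1/(n-1)$, then the Schmidt, Siegel and Srinivasan bound is tight for all integers $k\in[2,n]$, i.e. $\overline{P}(n,k,p)=SSS(n,k,p)$. If $p>1/(n-1)$, then $\overline{P}(n,k,p)=SSS(n,k,p)$ for all integers $k$ with $$\left\lceil 1+(n-1)p\right\rceil\le k\le\left\lfloor\frac{n(n-1)p^2}{np-1}\right\rfloor.$$
   Context: $\overline{P}(n,k,p)$ denotes the maximum of $\mathbb{P}_\theta\left(\sum_{i=1}^n\tilde c_i\ge k\right)$ over all probability distributions $\theta$ of a random vector $(\tilde c_1,\ldots,\tilde c_n)$ on $\{0,1\}^n$ satisfying $\mathbb{P}_\theta(\tilde c_i=1)=p$ for all $1\le i\le n$ and $\mathbb{P}_\theta(\tilde c_i=1,\tilde c_j=1)=p^2$ for all $1\le i<j\le n$ (identical pairwise independent Bernoulli variables). For identical marginals, the (unordered) Chebyshev bound is $$CH(n,k,p)=\begin{cases}1, & k<np,\\[1mm] \dfrac{np(1-p)}{np(1-p)+(k-np)^2}, & np\le k\le n,\end{cases}$$ and the (unordered) Schmidt, Siegel and Srinivasan bound, for $k\ge 2$, is $$SSS(n,k,p)=\min\left(1,\ \frac{np}{k},\ \frac{n(n-1)p^2}{k(k-1)}\right).$$ *)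

(* Defs.v *)
From HB Require Import structures.
From mathcomp Require Import all_boot all_order all_algebra.
From mathcomp Require Import classical_sets reals.
Set Implicit Arguments.
Unset Strict Implicit.
Unset Printing Implicit Defensive.
Import Order.TTheory GRing.Theory Num.Theory.
Local Open Scope ring_scope.

(* Laws of a random vector on {0,1}^n are given by their mass functions. *)
Definition is_distribution (R : realType) (n : nat)
    (theta : {ffun {ffun 'I_n -> bool} -> R}) : Prop :=
  (forall c, 0 <= theta c) /\ \sum_c theta c = 1.

Definition prob (R : realType) (n : nat)
    (theta : {ffun {ffun 'I_n -> bool} -> R})
    (E : pred {ffun 'I_n -> bool}) : R :=
  \sum_(c | E c) theta c.

Definition pairwise_indep_bernoulli (R : realType) (n : nat) (p : R)
    (theta : {ffun {ffun 'I_n -> bool} -> R}) : Prop :=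
  [/\ is_distribution theta,
      forall i : 'I_n, prob theta (fun c => c i) = p
    & forall i j : 'I_n, (i < j)%N ->
        prob theta (fun c => c i && c j) = p ^+ 2].

(* The booleans [c i] are coerced to 0 and 1 in the sum. *)
Definition tail_prob (R : realType) (n k : nat)
    (theta : {ffun {ffun 'I_n -> bool} -> R}) : R :=
  prob theta (fun c => (k <= \sum_(i < n) c i)%N).

Definition tail_probs (R : realType) (n k : nat) (p : R) : set R :=
  [set x | exists2 theta : {ffun {ffun 'I_n -> bool} -> R},
             pairwise_indep_bernoulli p theta & x = tail_prob k theta]%classic.

(* [is_Pbar n k p v] means that the maximum defining Pbar(n, k, p) exists,
   i.e. is attained, and equals v. *)
Definition is_Pbar (R : realType) (n k : nat) (p v : R) : Prop :=
  tail_probs n k p v /\ ubound (tail_probs n k p) v.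

Definition CH (R : realType) (n k : nat) (p : R) : R :=
  if k%:R < n%:R * p then 1
  else n%:R * p * (1 - p) /
       (n%:R * p * (1 - p) + (k%:R - n%:R * p) ^+ 2).

Definition SSS (R : realType) (n k : nat) (p : R) : R :=
  Num.min 1
    (Num.min (n%:R * p / k%:R)
             (n%:R * (n%:R - 1) * p ^+ 2 / (k%:R * (k%:R - 1)))).

(* Main.v *)
Require Import Defs.
From HB Require Import structures.
From mathcomp Require Import all_boot all_order all_algebra.
From mathcomp Require Import fingroup perm.
From mathcomp Require Import classical_sets reals.
From mathcomp Require Import ring lra.
Set Implicit Arguments.
Unset Strict Implicit.
Unset Printing Implicit Defensive.
Import Order.TTheory GRing.Theory Num.Theory.
Local Open Scope ring_scope.

(** Everything depends on the weight S, the number of ones of the random vector.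
    Pairwise independence fixes its first two factorial moments,
    E S = n p and E S(S-1) = n (n-1) p^2.  Conversely, an exchangeable law (one
    whose mass function depends on S only) with these two moments is pairwise
    independent, since by symmetry all n marginals agree and all n (n-1) pair
    probabilities agree ([exchangeable_pairwise_indep]).  The statement is thus
    a moment problem on {0, ..., n}:

    - a quadratic in S that is nonnegative on {0, ..., n} and at least 1 on
      {k, ..., n} gives an upper bound for P(S >= k) ([tail_prob_le]);
    - the bound is attained by a mixture of uniform laws on the layers S = x,
      where x runs over the points at which the quadratic equals the indicator
      of S >= k ([is_Pbar_three_layers]).

    For the second-moment bound the quadratic is S(S-1)/(k(k-1)) and the layers
    are 0, 1 and k ([is_Pbar_factorial]).  The mixture weights are nonnegative
    exactly when (n-1) p <= k-1 and k (n p - 1) <= n (n-1) p^2, and this covers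
    (b) entirely.  It also covers k = alpha + 1 in (a), where the weight of
    layer 1 vanishes.  For k = n in (a), the Chebyshev quadratic
    ((S - alpha)/(n - alpha))^2 vanishes at the integer alpha = (n-1) p, so the
    layers are alpha and n ([is_Pbar_full]). *)

(** * Moments of the weight *)

(** The number of ones of a vector, written as in [tail_prob]. *)
Definition weight (n : nat) (c : {ffun 'I_n -> bool}) : nat :=
  (\sum_(i < n) c i)%N.

Lemma weight_le (n : nat) (c : {ffun 'I_n -> bool}) : (weight c <= n)%N.
Proof.
rewrite -[leqRHS]card_ord -sum1_card.
by apply: leq_sum => i _; case: (c i).
Qed.

Lemma prob_expectE (R : realType) (n : nat)
    (theta : {ffun {ffun 'I_n -> bool} -> R}) (E : pred {ffun 'I_n -> bool}) :
  prob theta E = \sum_c theta c * (E c)%:R.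
Proof.
rewrite /prob big_mkcond; apply: eq_bigr => c _.
by case: (E c); rewrite ?mulr1 ?mulr0.
Qed.

Lemma mean_weightE (R : realType) (n : nat)
    (theta : {ffun {ffun 'I_n -> bool} -> R}) :
  \sum_c theta c * (weight c)%:R = \sum_i prob theta (fun c => c i).
Proof.
under [RHS]eq_bigr => i _ do rewrite prob_expectE.
rewrite exchange_big; apply: eq_bigr => c _.
by rewrite natr_sum mulr_sumr.
Qed.

Lemma weight_factorial2 (R : realType) (n : nat) (c : {ffun 'I_n -> bool}) :
  (weight c)%:R * ((weight c)%:R - 1) =
  \sum_i \sum_(j | j != i) (c i && c j)%:R :> R.
Proof.
have weightE : (weight c)%:R = \sum_i (c i)%:R :> R by rewrite /weight natr_sum.
rewrite [X in X * _]weightE mulr_suml; apply: eq_bigr => i _.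
case ci: (c i) => /=; last by rewrite mul0r big1.
by rewrite mul1r weightE (bigD1 i) //= ci addrAC subrr add0r.
Qed.

Lemma factorial2_weightE (R : realType) (n : nat)
    (theta : {ffun {ffun 'I_n -> bool} -> R}) :
  \sum_c theta c * ((weight c)%:R * ((weight c)%:R - 1)) =
  \sum_i \sum_(j | j != i) prob theta (fun c => c i && c j).
Proof.
under eq_bigr => c _ do rewrite weight_factorial2 mulr_sumr.
rewrite exchange_big; apply: eq_bigr => i _.
under eq_bigr => c _ do rewrite mulr_sumr.
by rewrite exchange_big; apply: eq_bigr => j _; rewrite prob_expectE.
Qed.

Lemma sum_offdiag_const (R : realType) (n : nat) (a : R) :
  \sum_(i < n) \sum_(j < n | j != i) a = n%:R * (n%:R - 1) * a.
Proof.
have rowE i : \sum_(j < n | j != i) a = (n%:R - 1) * a.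
  have: \sum_(j < n) a = n%:R * a by rewrite sumr_const card_ord mulr_natl.
  by rewrite (bigD1 i) //= mulrBl mul1r => <-; rewrite addrAC subrr add0r.
under eq_bigr => i _ do rewrite rowE.
by rewrite sumr_const card_ord -mulrA mulr_natl.
Qed.

Lemma pairwise_indep_moments (R : realType) (n : nat) (p : R)
    (theta : {ffun {ffun 'I_n -> bool} -> R}) :
  pairwise_indep_bernoulli p theta ->
  \sum_c theta c * (weight c)%:R = n%:R * p /\
  \sum_c theta c * ((weight c)%:R * ((weight c)%:R - 1)) =
    n%:R * (n%:R - 1) * p ^+ 2.
Proof.
case=> _ marg pair; split.
  rewrite mean_weightE; under eq_bigr => i _ do rewrite marg.
  by rewrite sumr_const card_ord mulr_natl.
rewrite factorial2_weightE -sum_offdiag_const.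
apply: eq_bigr => i _; apply: eq_bigr => j ji.
case: (ltngtP i j) => [ij|ij|/val_inj ij]; first exact: pair.
  by rewrite -(pair _ _ ij); apply: eq_bigl => c; rewrite andbC.
by rewrite ij eqxx in ji.
Qed.

(** The dual bound: a quadratic dominating the indicator of S >= k bounds the
    tail by its expectation. *)
Lemma tail_prob_le (R : realType) (n k : nat) (p a b d : R)
    (theta : {ffun {ffun 'I_n -> bool} -> R}) :
  pairwise_indep_bernoulli p theta ->
  (forall j : nat, (j <= n)%N ->
     ((k <= j)%N)%:R <= a + b * j%:R + d * (j%:R * (j%:R - 1))) ->
  tail_prob k theta <= a + b * (n%:R * p) + d * (n%:R * (n%:R - 1) * p ^+ 2).
Proof.
move=> indep dom; have [mom1 mom2] := pairwise_indep_moments indep.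
have [[theta_ge0 theta_sum] _ _] := indep.
rewrite -mom1 -mom2 -[X in X + _ + _]mulr1 -[X in _ * X + _ + _]theta_sum.
rewrite !mulr_sumr -!big_split /tail_prob prob_expectE.
apply: ler_sum => c _ /=.
have := ler_wpM2l (theta_ge0 c) (dom _ (weight_le c)).
by rewrite /weight; congr (_ <= _); ring.
Qed.

(** * Exchangeable laws *)

(** The mass of a vector depends on its weight only; on {0,1}^n this is
    invariance under permutation of the coordinates. *)
Definition exchangeable (R : realType) (n : nat)
    (theta : {ffun {ffun 'I_n -> bool} -> R}) : Prop :=
  forall c c', weight c = weight c' -> theta c = theta c'.

Lemma exchangeable_prob_perm (R : realType) (n : nat)
    (theta : {ffun {ffun 'I_n -> bool} -> R}) (s : {perm 'I_n})
    (E : pred {ffun 'I_n -> bool}) :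
  exchangeable theta ->
  prob theta E = prob theta (fun c => E [ffun i => c (s i)]).
Proof.
move=> exch.
have permI : injective (fun c : {ffun 'I_n -> bool} => [ffun i => c (s i)]).
  move=> c c' /ffunP cc'; apply/ffunP => i.
  by have := cc' (s^-1%g i); rewrite !ffunE permKV.
rewrite {1}/prob (reindex_inj permI); apply: eq_bigr => c _; apply: exch.
rewrite /weight [RHS](reindex_inj (@perm_inj _ s)).
by apply: eq_bigr => i _; rewrite ffunE.
Qed.

Lemma exchangeable_marginal (R : realType) (n : nat)
    (theta : {ffun {ffun 'I_n -> bool} -> R}) (i i' : 'I_n) :
  exchangeable theta ->
  prob theta (fun c => c i) = prob theta (fun c => c i').
Proof.
move=> /(exchangeable_prob_perm (tperm i i'))->.
by apply: eq_bigl => c; rewrite ffunE tpermL.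
Qed.

Lemma exchangeable_pair (R : realType) (n : nat)
    (theta : {ffun {ffun 'I_n -> bool} -> R}) (i j i' j' : 'I_n) :
  exchangeable theta -> i != j -> i' != j' ->
  prob theta (fun c => c i && c j) = prob theta (fun c => c i' && c j').
Proof.
move=> exch ij ij'.
(* The first transposition maps i to i'; the second one fixes i' and maps the
   image of j to j'. *)
pose s := (tperm i i' * tperm (tperm i i' j) j')%g.
have si : s i = i'.
  rewrite permM tpermL tpermD // 1?eq_sym //.
  by rewrite -{1}(tpermL i i') (inj_eq perm_inj).
have sj : s j = j' by rewrite permM tpermL.
rewrite (exchangeable_prob_perm s _ exch).
by apply: eq_bigl => c; rewrite !ffunE si sj.
Qed.

(** By symmetry the moments of the weight determine the marginals and the pair
    probabilities of an exchangeable law. *)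
Lemma exchangeable_pairwise_indep (R : realType) (n : nat) (p : R)
    (theta : {ffun {ffun 'I_n -> bool} -> R}) :
  is_distribution theta -> exchangeable theta ->
  \sum_c theta c * (weight c)%:R = n%:R * p ->
  \sum_c theta c * ((weight c)%:R * ((weight c)%:R - 1)) =
    n%:R * (n%:R - 1) * p ^+ 2 ->
  pairwise_indep_bernoulli p theta.
Proof.
move=> dist exch mom1 mom2; split=> // [i|i j ij].
  have n_neq0 : n%:R != 0 :> R.
    by rewrite pnatr_eq0 -lt0n (leq_ltn_trans _ (ltn_ord i)).
  apply: (mulfI n_neq0); rewrite -mom1 mean_weightE.
  under [RHS]eq_bigr => i' _ do rewrite (exchangeable_marginal i' i exch).
  by rewrite sumr_const card_ord mulr_natl.
have n_gt1 : (1 < n)%N by apply: leq_ltn_trans (ltn_ord j); apply: leq_trans ij.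
have nn_neq0 : n%:R * (n%:R - 1) != 0 :> R.
  by rewrite mulf_eq0 negb_or subr_eq0 pnatr_eq0 pnatr_eq1 !gtn_eqF // ltnW.
apply: (mulfI nn_neq0); rewrite -mom2 factorial2_weightE -sum_offdiag_const.
apply: eq_bigr => i' _; apply: eq_bigr => j' ij'.
by apply: exchangeable_pair => //; rewrite 1?eq_sym // neq_ltn ij orbT.
Qed.

(** * Uniform laws on layers *)

(** The uniform law on the vectors of weight [x]; it is a distribution as soon
    as this layer is nonempty, that is when [x <= n]. *)
Definition layer_law (R : realType) (n x : nat) :
    {ffun {ffun 'I_n -> bool} -> R} :=
  [ffun c => (weight c == x)%:R /
             #|[pred d : {ffun 'I_n -> bool} | weight d == x]|%:R].

Lemma layer_law_ge0 (R : realType) (n x : nat) (c : {ffun 'I_n -> bool}) :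
  0 <= layer_law R n x c.
Proof. by rewrite ffunE divr_ge0. Qed.

Lemma layer_nonempty (n x : nat) : (x <= n)%N ->
  (0 < #|[pred d : {ffun 'I_n -> bool} | weight d == x]|)%N.
Proof.
move=> xn; apply/card_gt0P; exists [ffun i : 'I_n => (i < x)%N].
rewrite inE /weight; apply/eqP.
under eq_bigr => i _ do rewrite ffunE.
rewrite -(big_mkord xpredT (fun i => nat_of_bool (i < x)%N)).
rewrite (big_cat_nat (leq0n x) xn) //= [X in (_ + X)%N]big_nat_cond.
rewrite [X in (_ + X)%N]big1 ?addn0; last first.
  by move=> i /andP[/andP[xi _] _]; rewrite ltnNge xi.
rewrite big_nat_cond (eq_bigr (fun=> 1%N)); last first.
  by move=> i /andP[/andP[_ ->] _].
by rewrite -big_nat_cond sum_nat_const_nat subn0 muln1.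
Qed.

Lemma layer_law_expect (R : realType) (n x : nat) (g : nat -> R) :
  (x <= n)%N -> \sum_c layer_law R n x c * g (weight c) = g x.
Proof.
move=> xn; set N := #|[pred d : {ffun 'I_n -> bool} | weight d == x]|.
have N_neq0 : N%:R != 0 :> R by rewrite pnatr_eq0 -lt0n layer_nonempty.
rewrite (eq_bigr (fun c => if weight c == x then g x / N%:R else 0)).
  by rewrite -big_mkcond sumr_const -[LHS]mulr_natr divfK.
move=> c _; rewrite ffunE -/N; case: eqP => [->|_]; last by rewrite !mul0r.
by rewrite mul1r mulrC.
Qed.

(** Primal and dual solutions together: the value of a mixture of three layers
    with the prescribed moments is the maximum as soon as the expectation of a
    quadratic dominating the indicator of S >= k does not exceed it. *)
Lemma is_Pbar_three_layers (R : realType) (n k x y z : nat)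
    (p u v w a b d val : R) :
  (x <= n)%N -> (y <= n)%N -> (z <= n)%N ->
  0 <= u -> 0 <= v -> 0 <= w ->
  u + v + w = 1 ->
  u * x%:R + v * y%:R + w * z%:R = n%:R * p ->
  u * (x%:R * (x%:R - 1)) + v * (y%:R * (y%:R - 1)) + w * (z%:R * (z%:R - 1))
    = n%:R * (n%:R - 1) * p ^+ 2 ->
  u * ((k <= x)%N)%:R + v * ((k <= y)%N)%:R + w * ((k <= z)%N)%:R = val ->
  (forall j : nat, (j <= n)%N ->
     ((k <= j)%N)%:R <= a + b * j%:R + d * (j%:R * (j%:R - 1))) ->
  a + b * (n%:R * p) + d * (n%:R * (n%:R - 1) * p ^+ 2) <= val ->
  is_Pbar n k p val.
Proof.
move=> xn yn zn u0 v0 w0 mass mom1 mom2 tail dom dual; split; last first.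
  by move=> _ [theta indep ->]; apply: le_trans dual; apply: tail_prob_le.
pose theta : {ffun {ffun 'I_n -> bool} -> R} :=
  [ffun c => u * layer_law R n x c + v * layer_law R n y c
             + w * layer_law R n z c].
have expect (g : nat -> R) :
    \sum_c theta c * g (weight c) = u * g x + v * g y + w * g z.
  rewrite -(layer_law_expect g xn) -(layer_law_expect g yn).
  rewrite -(layer_law_expect g zn) !mulr_sumr -!big_split.
  by apply: eq_bigr => c _; rewrite ffunE !mulrDl !mulrA.
exists theta; last first.
  by rewrite /tail_prob prob_expectE (expect (fun j => ((k <= j)%N)%:R)).
apply: exchangeable_pairwise_indep.
- split=> [c|]; first by rewrite ffunE !addr_ge0 ?mulr_ge0 ?layer_law_ge0.
  rewrite -mass -[u]mulr1 -[v]mulr1 -[w]mulr1 -(expect (fun=> 1)).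
  by apply: eq_bigr => c _; rewrite mulr1.
- by move=> c c' cc'; rewrite !ffunE cc'.
- by rewrite (expect (fun j => j%:R)).
- by rewrite (expect (fun j => j%:R * (j%:R - 1))).
Qed.

(** * The two extremal problems *)

(** The masses of the layers 0, 1 and k in the unique solution of the moment
    equations supported on these layers. *)
Lemma factorial_masses_ge0 (R : realType) (n k : nat) (p : R) :
  0 < p -> (2 <= k <= n)%N ->
  (n%:R - 1) * p <= k%:R - 1 ->
  k%:R * (n%:R * p - 1) <= n%:R * (n%:R - 1) * p ^+ 2 ->
  let val := n%:R * (n%:R - 1) * p ^+ 2 / (k%:R * (k%:R - 1)) in
  [/\ 0 <= 1 - n%:R * p + (k%:R - 1) * val,
      0 <= n%:R * p - k%:R * val & 0 <= val].
Proof.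
move=> p0 /andP[k2 kn] layer1 layer0 /=.
have k2R : 2 <= k%:R :> R by rewrite ler_nat.
have knR : k%:R <= n%:R :> R by rewrite ler_nat.
have k_gt0 : 0 < k%:R :> R by lra.
have k1_gt0 : 0 < k%:R - 1 :> R by lra.
have np_ge0 : 0 <= n%:R * p by rewrite mulr_ge0 // ltW.
split.
- have -> : (k%:R - 1) * (n%:R * (n%:R - 1) * p ^+ 2 / (k%:R * (k%:R - 1))) =
      n%:R * (n%:R - 1) * p ^+ 2 / k%:R by field; rewrite !gt_eqF.
  suff: n%:R * p - 1 <= n%:R * (n%:R - 1) * p ^+ 2 / k%:R by lra.
  by rewrite ler_pdivlMr // mulrC.
- have -> : k%:R * (n%:R * (n%:R - 1) * p ^+ 2 / (k%:R * (k%:R - 1))) =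
      n%:R * p * ((n%:R - 1) * p) / (k%:R - 1) by field; rewrite !gt_eqF.
  by rewrite subr_ge0 ler_pdivrMr // ler_wpM2l.
- have n1_ge0 : 0 <= n%:R - 1 :> R by lra.
  by rewrite divr_ge0 ?mulr_ge0 ?sqr_ge0 // ltW.
Qed.

Lemma is_Pbar_factorial (R : realType) (n k : nat) (p : R) :
  0 < p -> (2 <= k <= n)%N ->
  (n%:R - 1) * p <= k%:R - 1 ->
  k%:R * (n%:R * p - 1) <= n%:R * (n%:R - 1) * p ^+ 2 ->
  is_Pbar n k p (n%:R * (n%:R - 1) * p ^+ 2 / (k%:R * (k%:R - 1))).
Proof.
move=> p0 k2n layer1 layer0.
have [] := factorial_masses_ge0 p0 k2n layer1 layer0.
case/andP: k2n => k2 kn.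
have k2R : 2 <= k%:R :> R by rewrite ler_nat.
have k1_gt0 : 0 < k%:R - 1 :> R by lra.
have kk_gt0 : 0 < k%:R * (k%:R - 1) :> R by rewrite mulr_gt0 //; lra.
set val := _ / _ => mass0 mass1 massk.
have valE : val * (k%:R * (k%:R - 1)) = n%:R * (n%:R - 1) * p ^+ 2.
  by rewrite divfK // gt_eqF.
apply: (@is_Pbar_three_layers _ _ _ 0 1 k _
  (1 - n%:R * p + (k%:R - 1) * val) (n%:R * p - k%:R * val) val
  0 0 (k%:R * (k%:R - 1))^-1) => //.
- by rewrite (leq_trans _ kn) // ltnW.
- by ring.
- by ring.
- by rewrite -valE; ring.
- by rewrite leqnn leqNgt ltnW // leqNgt k2 /=; ring.
- move=> j jn; rewrite mul0r !add0r mulrC.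
  case: leqP => [kj|_] /=.
    have kjR : k%:R <= j%:R :> R by rewrite ler_nat.
    by rewrite ler_pdivlMr // mul1r ler_pM ?(ltW k1_gt0) //; lra.
  rewrite divr_ge0 ?(ltW kk_gt0) //.
  case: j jn => [|j] _; first by rewrite mul0r.
  by rewrite mulr_ge0 // subr_ge0 ler1n.
- by rewrite mul0r !add0r mulrC.
Qed.

(** Under the same conditions the second-moment term is the smallest of the
    three. *)
Lemma SSS_factorial (R : realType) (n k : nat) (p : R) :
  0 < p -> (2 <= k <= n)%N ->
  (n%:R - 1) * p <= k%:R - 1 ->
  k%:R * (n%:R * p - 1) <= n%:R * (n%:R - 1) * p ^+ 2 ->
  SSS n k p = n%:R * (n%:R - 1) * p ^+ 2 / (k%:R * (k%:R - 1)).
Proof.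
move=> p0 k2n layer1 layer0.
have [] := factorial_masses_ge0 p0 k2n layer1 layer0.
case/andP: k2n => k2 _.
have k_gt0 : 0 < k%:R :> R by rewrite ltr0n ltnW.
rewrite /SSS; set val := n%:R * (n%:R - 1) * _ / _ => mass0 mass1 massk.
rewrite [Num.min (_ / _) _]min_r; last first.
  by rewrite ler_pdivlMr // mulrC; lra.
(* The three masses sum to 1, hence each is at most 1. *)
by rewrite min_r //; lra.
Qed.

(** For k = n and (n-1) p = alpha, the quadratic is the square of
    (S - alpha)/(n - alpha); alpha + 2 <= n ensures p < 1. *)
Lemma is_Pbar_full (R : realType) (n alpha : nat) (p : R) :
  (1 <= alpha)%N -> (alpha + 2 <= n)%N -> p = alpha%:R / (n%:R - 1) ->
  is_Pbar n n p (p / (p + n%:R * (1 - p))).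
Proof.
move=> a1 an pE.
have a1R : 1 <= alpha%:R :> R by rewrite ler1n.
have anR : alpha%:R + 2 <= n%:R :> R by rewrite -natrD ler_nat.
have n1_gt0 : 0 < n%:R - 1 :> R by lra.
have aE : alpha%:R = (n%:R - 1) * p by rewrite pE mulrC divfK // gt_eqF.
have p_gt0 : 0 < p by rewrite pE divr_gt0 //; lra.
have p_lt1 : p < 1 by rewrite pE ltr_pdivrMr // mul1r; lra.
have q_gt0 : 0 < n%:R * (1 - p) by rewrite mulr_gt0; lra.
have D_gt0 : 0 < p + n%:R * (1 - p) by lra.
have DE : p + n%:R * (1 - p) = n%:R - alpha%:R by rewrite aE; ring.
have D_neq0 : p + n%:R * (1 - p) != 0 by rewrite gt_eqF.
apply: (@is_Pbar_three_layers _ _ _ alpha alpha n _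
  (n%:R * (1 - p) / (p + n%:R * (1 - p))) 0 (p / (p + n%:R * (1 - p)))
  (alpha%:R ^+ 2 / (n%:R - alpha%:R) ^+ 2)
  ((1 - 2 * alpha%:R) / (n%:R - alpha%:R) ^+ 2)
  ((n%:R - alpha%:R) ^- 2)) => //.
- by apply: leq_trans an; rewrite leq_addr.
- by apply: leq_trans an; rewrite leq_addr.
- by rewrite divr_ge0 // ltW.
- by rewrite divr_ge0 // ltW.
- by rewrite addr0; field.
- by rewrite aE; field.
- by rewrite aE; field.
- rewrite leqnn [(n <= _)%N]leqNgt (leq_trans _ an) ?addn2 //=; ring.
- move=> j jn.
  have -> : alpha%:R ^+ 2 / (n%:R - alpha%:R) ^+ 2 +
      (1 - 2 * alpha%:R) / (n%:R - alpha%:R) ^+ 2 * j%:R +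
      (n%:R - alpha%:R) ^- 2 * (j%:R * (j%:R - 1)) =
      ((j%:R - alpha%:R) / (n%:R - alpha%:R)) ^+ 2 :> R.
    by field; rewrite -DE.
  case: leqP => [nj|_]; last exact: sqr_ge0.
  have -> : j = n by apply/eqP; rewrite eqn_leq jn.
  by rewrite divff -?DE // expr1n.
- rewrite aE le_eqVlt; apply/orP; left; apply/eqP.
  by field.
Qed.

Theorem proposition4p3 (R : realType) (n : nat) (p : R)
    (hn : (3 <= n)%N) (hp0 : 0 < p) (hp1 : p < 1) :
  (forall alpha : nat, (1 <= alpha <= n - 2)%N ->
     p = alpha%:R / (n%:R - 1) ->
     is_Pbar n alpha.+1 p (CH n alpha.+1 p) /\ is_Pbar n n p (CH n n p))
  /\
  ((p <= 1 / (n%:R - 1) ->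
      forall k : nat, (2 <= k <= n)%N -> is_Pbar n k p (SSS n k p))
   /\
   (1 / (n%:R - 1) < p ->
      forall k : nat,
        Num.ceil (1 + (n%:R - 1) * p) <= k%:Z
          <= Num.floor (n%:R * (n%:R - 1) * p ^+ 2 / (n%:R * p - 1)) ->
        is_Pbar n k p (SSS n k p))).
Proof.
have n3R : 3 <= n%:R :> R by rewrite ler_nat.
have n1_gt0 : 0 < n%:R - 1 :> R by lra.
have np_gt0 : 0 < n%:R * p by rewrite mulr_gt0 //; lra.
split; [|split].
- move=> alpha /andP[a1 an] pE.
  have an2 : (alpha + 2 <= n)%N by rewrite addnC -leq_subRL // ltnW.
  have aE : alpha%:R = (n%:R - 1) * p by rewrite pE mulrC divfK // gt_eqF.
  have kE : alpha.+1%:R = (n%:R - 1) * p + 1 by rewrite -natr1 aE.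
  have q_gt0 : 0 < 1 - p by lra.
  have npq_gt0 : 0 < n%:R * p * (1 - p) by rewrite mulr_gt0.
  split.
    have k_gt0 : 0 < (n%:R - 1) * p + 1 by rewrite ltr_wpDl // mulr_ge0 // ltW.
    have -> : CH n alpha.+1 p =
        n%:R * (n%:R - 1) * p ^+ 2 / (alpha.+1%:R * (alpha.+1%:R - 1)).
      rewrite /CH kE ifF; last by apply/negbTE; rewrite -leNgt; lra.
      have D_gt0 : 0 < n%:R * p * (1 - p) + ((n%:R - 1) * p + 1 - n%:R * p) ^+ 2.
        by rewrite ltr_wpDr // sqr_ge0.
      by field; rewrite addrK mulf_neq0 ?gt_eqF.
    apply: is_Pbar_factorial => //.
    - by rewrite !ltnS a1 (leq_trans _ an2) // addn2.
    - by rewrite kE addrK.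
    - rewrite kE.
      have -> : n%:R * (n%:R - 1) * p ^+ 2 =
          ((n%:R - 1) * p + 1) * (n%:R * p - 1) + (1 - p) by ring.
      by rewrite lerDl ltW.
  have -> : CH n n p = p / (p + n%:R * (1 - p)).
    have nq_gt0 : 0 < n%:R * (1 - p) by rewrite mulr_gt0 //; lra.
    rewrite /CH ifF; last first.
      by apply/negbTE; rewrite -leNgt -subr_ge0; lra.
    have D_gt0 : 0 < n%:R * p * (1 - p) + (n%:R - n%:R * p) ^+ 2.
      by rewrite ltr_wpDr // sqr_ge0.
    by field; rewrite !gt_eqF // addr_gt0.
  exact: (is_Pbar_full a1 an2).
- move=> ple k k2n; have /andP[k2 kn] := k2n.
  have k2R : 2 <= k%:R :> R by rewrite ler_nat.
  have knR : k%:R <= n%:R :> R by rewrite ler_nat.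
  have n1p : (n%:R - 1) * p <= 1 by rewrite mulrC -ler_pdivlMr.
  have layer1 : (n%:R - 1) * p <= k%:R - 1 by lra.
  have layer0 : k%:R * (n%:R * p - 1) <= n%:R * (n%:R - 1) * p ^+ 2.
    (* Increase k to n if n p >= 1; otherwise the left side is negative. *)
    have [np1|np1] := leP 1 (n%:R * p); last first.
      rewrite (@le_trans _ _ 0) //; last by rewrite !mulr_ge0 ?sqr_ge0 // ltW.
      by rewrite mulr_ge0_le0 //; lra.
    have np1_ge0 : 0 <= n%:R * p - 1 by lra.
    rewrite (le_trans (ler_wpM2r np1_ge0 knR)) // -subr_ge0.
    have -> : n%:R * (n%:R - 1) * p ^+ 2 - n%:R * (n%:R * p - 1) =
        n%:R * ((1 - p) * (1 - (n%:R - 1) * p)) by ring.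
    by rewrite mulr_ge0 // mulr_ge0 //; lra.
  by rewrite SSS_factorial //; apply: is_Pbar_factorial.
- move=> pgt k /andP[]; rewrite ceil_le_int floor_ge_int.
  rewrite -!pmulrn => lo hi.
  have n1p : 1 < (n%:R - 1) * p by rewrite mulrC -ltr_pdivrMr.
  have np1_gt0 : 0 < n%:R * p - 1 by lra.
  have layer1 : (n%:R - 1) * p <= k%:R - 1 by lra.
  have layer0 : k%:R * (n%:R * p - 1) <= n%:R * (n%:R - 1) * p ^+ 2.
    by rewrite -ler_pdivlMr.
  have k2 : (2 <= k)%N by rewrite -(ler_nat R); lra.
  have kn : (k <= n)%N.
    rewrite -(ler_nat R) -(ler_pM2r np1_gt0) (le_trans layer0) //.
    rewrite -subr_ge0.
    have -> : n%:R * (n%:R * p - 1) - n%:R * (n%:R - 1) * p ^+ 2 =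
        n%:R * ((1 - p) * ((n%:R - 1) * p - 1)) by ring.
    by rewrite mulr_ge0 // mulr_ge0 //; lra.
  by rewrite SSS_factorial ?k2 //; apply: is_Pbar_factorial => //; rewrite k2.
Qed.
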